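(* Let $r,\ell\geqslant 3$ be fixed integers. Run the random greedy high linear-girth $r$-clique removal process on vertex set $[n]$, and let $M$ be the number of edges of the linear $r$-graph (of linear girth greater than $\ell$) produced when the process terminates. Then, with high probability (i.e. with probability tending to $1$ as $n\to\infty$), for some positive constant $\lambda=\lambda(\ell)$ depending only on $\ell$, \[ M\geqslant n^{1+\frac{1}{\ell-1}-\lambda\frac{\log\log n}{\log n}}. \]
   Context: For an integer $r\geqslant 3$, an $r$-graph on $[n]=\{1,\dots,n\}$ is a set of $r$-element subsets (edges) of $[n]$; it is linear if any two distinct edges share at most one vertex. For $j\geqslant 3$, the $r$-uniform linear cycle $C_j^r$ is the $r$-graph on $(r-1)j$ vertices with edges $e_1,\dots,e_j$ such that $|e_a\cap e_b|=1$ if $b\equiv a\pm 1 \pmod j$ and $e_a\cap e_b=\emptyset$ otherwise. The linear girth of a linear $r$-graph is the smallest $j$ such that it contains a copy of $C_j^r$ (infinite if there is none). Logarithms are natural. The random greedy high linear-girth $r$-clique removal process (for fixed $r,\ell\geqslant3$): let $\mathcal{L}=\{C_j^r: 3\leqslant j\leqslant \ell\}$. Start with $\mathbb{G}(0)$ the complete graph on $[n]$ and $\mathbb{H}(0)$ the empty $r$-graph on $[n]$. At step $i$, an $r$-set $\boldsymbol{f}\subseteq[n]$ is called available if all $\binom r2$ pairs inside $\boldsymbol f$ are edges of $\mathbb{G}(i)$ and $\mathbb{H}(i)\cup\{\boldsymbol f\}$ contains no copy of a member of $\mathcal L$; let $Q(i)$ be the set of available $r$-sets. If $Q(i)=\emptyset$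 the process terminates; otherwise an $r$-set $\boldsymbol e_{i+1}$ is chosen uniformly at random from $Q(i)$, $\mathbb H(i+1)=\mathbb H(i)\cup\{\boldsymbol e_{i+1}\}$, and $\mathbb G(i+1)$ is obtained from $\mathbb G(i)$ by deleting the $\binom r2$ pairs contained in $\boldsymbol e_{i+1}$. Thus $\mathbb G(i)$ is the graph of pairs not covered by any edge of $\mathbb H(i)$, and every $\mathbb H(i)$ is a linear $r$-graph with linear girth greater than $\ell$. *)

(* Defs.v *)
From mathcomp Require Import all_boot all_order all_algebra.

Set Implicit Arguments.
Unset Strict Implicit.
Unset Printing Implicit Defensive.

Import Order.TTheory GRing.Theory Num.Theory.

Local Open Scope ring_scope.

(* The vertex set [n] is represented by 'I_n. Both graphs and r-graphs are
   given by their sets of edges. *)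
Notation hypergraph n := {set {set 'I_n}}.

Definition pairs_in (n : nat) (f : {set 'I_n}) : hypergraph n :=
  [set p : {set 'I_n} | (p \subset f) && (#|p| == 2)].

Definition cyc_adj (j : nat) (a b : 'I_j) : bool :=
  (b == a.+1 %[mod j])%N || (a == b.+1 %[mod j])%N.

(* The vertex count excludes, for j = 3, three edges with a common vertex. *)
Definition contains_linear_cycle (r j n : nat) (H : hypergraph n) : bool :=
  [exists e : {ffun 'I_j -> {set 'I_n}},
    [&& [forall a, (e a \in H) && (#|e a| == r)],
        [forall a, forall b, (a != b) ==> (#|e a :&: e b| == cyc_adj a b)]
      & #|\bigcup_a e a| == ((r - 1) * j)%N]].

(* A state is the pair (G(i), H(i)). *)
Notation state n := (hypergraph n * hypergraph n)%type.

Definition init_state (n : nat) : state n :=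
  (pairs_in [set: 'I_n], set0).

Definition next_state (n : nat) (s : state n) (e : {set 'I_n}) : state n :=
  (s.1 :\: pairs_in e, e |: s.2).

Definition available (r l n : nat) (s : state n) : hypergraph n :=
  [set f : {set 'I_n} |
    [&& #|f| == r, pairs_in f \subset s.1
      & [forall j : 'I_l.+1,
          (3 <= j)%N ==> ~~ contains_linear_cycle r j (f |: s.2)]]].

Definition terminated (r l n : nat) (s : state n) : bool :=
  available r l s == set0.

(* Terminated states are absorbing, so that the law is defined at all times. *)
Definition transition (R : realFieldType) (r l n : nat) (s t : state n) : R :=
  if terminated r l s then (t == s)%:R
  else \sum_(e in available r l s) (t == next_state s e)%:R / #|available r l s|%:R.

Fixpoint law (R : realFieldType) (r l n i : nat) (t : state n) : R :=
  if i is i'.+1 then \sum_s law R r l i' s * transition R r l s t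
  else (t == init_state n)%:R.

(* The probability that M >= x, where M is the number of edges of the r-graph
   present at termination. Every run has stopped by time 'C(n, r), the number
   of r-subsets of [n]: see [law_terminated]. *)
Definition prob_final_edges_ge (R : realFieldType) (r l n : nat) (x : R) : R :=
  \sum_(s : state n | terminated r l s && (x <= #|s.2|%:R)) law R r l 'C(n, r) s.

Lemma law_ge0 (R : realFieldType) (r l n i : nat) (s : state n) :
  0 <= law R r l i s.
Proof.
elim: i s => [|i IHi] s /=; first by rewrite ler0n.
apply: sumr_ge0 => u _; apply: mulr_ge0 => //; rewrite /transition.
case: ifP => _; first by rewrite ler0n.
by apply: sumr_ge0 => e _; rewrite divr_ge0 ?ler0n.
Qed.

Lemma law_sum1 (R : realFieldType) (r l n i : nat) :
  \sum_(s : state n) law R r l i s = 1.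
Proof.
have dirac (u : state n) : \sum_t (t == u)%:R = 1 :> R.
  rewrite (bigD1 u) //= eqxx big1 ?addr0 // => t /negPf->; exact: erefl.
elim: i => [|i IHi] /=; first exact: dirac.
rewrite exchange_big /= -[RHS]IHi; apply: eq_bigr => s _.
rewrite -mulr_sumr -[RHS]mulr1; congr (_ * _); rewrite /transition.
have [_|nt] := boolP (terminated r l s); first exact: dirac.
rewrite exchange_big /= (eq_bigr (fun=> #|available r l s|%:R^-1)); last first.
  by move=> e _; rewrite -mulr_suml dirac mul1r.
by rewrite sumr_const -[LHS]mulr_natl mulfV // pnatr_eq0 cards_eq0.
Qed.

Lemma law_terminated (R : realFieldType) (r l n : nat) (s : state n) :
  (1 < r)%N -> law R r l 'C(n, r) s != 0 -> terminated r l s.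
Proof.
move=> r_gt1.
have pairs_n0 (f : {set 'I_n}) : #|f| = r -> exists p, p \in pairs_in f.
  move=> fr; have [x [y [xf yf xy]]] : exists x y, [/\ x \in f, y \in f & x != y].
    by apply/card_gt1P; rewrite fr.
  by exists [set x; y]; rewrite inE cards2 xy subUset !sub1set xf yf.
pose good i (u : state n) :=
  [/\ forall f, f \in u.2 -> #|f| = r,
      forall f, f \in u.2 -> [disjoint pairs_in f & u.1]
    & terminated r l u \/ #|u.2| = i].
have fresh i (u : state n) e : good i u -> e \in available r l u -> e \notin u.2.
  case=> _ D _; rewrite inE => /and3P[/eqP er eG _]; apply/negP => /D.
  have [p pe] := pairs_n0 e er.
  by move=> /disjointFr/(_ pe); rewrite (subsetP eG).
have law_good i u : law R r l i u != 0 -> good i u.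
  elim: i u => [|i IHi] u /=.
    case: (u =P _) => [-> _|_]; last by rewrite eqxx.
    by split=> [f|f|]; rewrite ?inE //; right; rewrite cards0.
  have [/existsP[v /andP[v0 t0]] _|/existsPn all0] :=
    boolP [exists v, (law R r l i v != 0) && (transition R r l v u != 0)]; last first.
    rewrite big1 ?eqxx // => v _; apply/eqP; rewrite mulf_eq0.
    by move: (all0 v); rewrite negb_and !negbK.
  have gv := IHi _ v0; have [A D T] := gv; move: t0; rewrite /transition.
  case: ifPn => [tv|ntv].
    by case: (u =P v) => [->|_]; rewrite ?eqxx //; split=> //; left.
  have [/existsP[e /andP[eQ /eqP->]] _|/existsPn all0] :=
    boolP [exists e, (e \in available r l v) && (u == next_state v e)]; last first.
    rewrite big1 ?eqxx // => e eQ; move: (all0 e); rewrite eQ /= => /negPf->.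
    by rewrite mul0r.
  have eH := fresh _ _ _ gv eQ.
  split=> [f|f|] /=.
  - by rewrite !inE => /predU1P[->|/A//]; move: eQ; rewrite inE => /and3P[/eqP].
  - rewrite !inE => /predU1P[->|/D fD].
      by rewrite disjoint_sym disjoints_subset setDE subsetIr.
    by apply: disjointWr fD; exact: subsetDl.
  - by right; rewrite cardsU1 eH; case: T => [tv|->//]; rewrite tv in ntv.
move=> /law_good gs; have [A D [//|Hcard]] := gs.
have H_all : s.2 = [set f : {set 'I_n} | #|f| == r].
  apply/eqP; rewrite eqEcard Hcard card_draws card_ord leqnn andbT.
  by apply/subsetP => f /A fr; rewrite inE fr.
apply/eqP/setP => f; rewrite [RHS]inE; apply/negP => fQ.
have := fresh _ _ _ gs fQ; rewrite H_all inE.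
by move: fQ; rewrite inE => /and3P[->].
Qed.

(* Main.v *)
(** Write [N = n^(1/(l-1))], [y = log n], and fix a degree bound [D ~ N/y].  An
    [r]-set that is unavailable contains two vertices at distance at most [l-1]
    in the current hypergraph, so as long as all degrees are at most [D] there
    are only [O(n (rD)^(l-1) n^(r-2)) = o(n^r)] of them, and at least half of
    all [r]-sets are available.  Hence a given vertex is hit at each step with
    probability at most [2r/n], and the exponential potential
    [sum_v exp(deg v)] grows by a factor at most [1 + O(r/n)] per step.  Over
    [m ~ n N / y^2] steps it stays below [exp(D)] with high probability, so no
    degree exceeds [D] and the process cannot stop before [m] edges. *)

Require Import Defs.
From mathcomp Require Import all_boot all_order all_algebra.
From mathcomp Require Import zify ring lra.

Set Implicit Arguments.
Unset Strict Implicit.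
Unset Printing Implicit Defensive.

Import Order.TTheory GRing.Theory Num.Theory.

(** * Degrees and balls in a hypergraph *)

Definition deg n (H : hypergraph n) (v : 'I_n) : nat :=
  #|[set e in H | v \in e]|.

(** [v] is added by hand so that an isolated vertex stays in its own neighbourhood and balls grow
    with the radius. *)
Definition nbhd n (H : hypergraph n) (v : 'I_n) : {set 'I_n} :=
  v |: \bigcup_(e in [set e in H | v \in e]) e.

Definition ball n (H : hypergraph n) (k : nat) (v : 'I_n) : {set 'I_n} :=
  iter k (fun A : {set 'I_n} => \bigcup_(w in A) nbhd H w) [set v].

Lemma card_bigcup_le (I T : finType) (A : {set I}) (F : I -> {set T}) (c : nat) :
  (forall i, i \in A -> #|F i| <= c) -> #|\bigcup_(i in A) F i| <= #|A| * c.
Proof.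
move=> Fc; rewrite -sum_nat_const; apply: (@leq_trans (\sum_(i in A) #|F i|)).
  elim/big_ind2: _ => [|x1 x2 y1 y2 h1 h2|//]; first by rewrite cards0.
  by apply: leq_trans (leq_card_setU _ _) (leq_add h1 h2).
exact: leq_sum.
Qed.

Lemma card_nbhd n (H : hypergraph n) (r D : nat) (v : 'I_n) :
  (forall e, e \in H -> #|e| = r) -> deg H v <= D -> #|nbhd H v| <= 1 + D * r.
Proof.
move=> Hr dD; rewrite cardsU1 leq_add ?leq_b1 //.
apply: leq_trans (leq_mul dD (leqnn r)); apply: card_bigcup_le => e.
by rewrite inE => /andP[/Hr-> _].
Qed.

Lemma card_ball n (H : hypergraph n) (r D k : nat) (v : 'I_n) :
  (forall e, e \in H -> #|e| = r) -> (forall w, deg H w <= D) ->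
  #|ball H k v| <= (1 + D * r) ^ k.
Proof.
move=> Hr dD; elim: k => [|k IHk]; first by rewrite /ball /= cards1 expn0.
rewrite expnSr; apply: leq_trans (leq_mul IHk (leqnn _)).
by apply: card_bigcup_le => w _; exact: card_nbhd.
Qed.

Lemma ball_step n (H : hypergraph n) (k : nat) (u z w : 'I_n) e :
  e \in H -> z \in ball H k u -> z \in e -> w \in e -> w \in ball H k.+1 u.
Proof.
move=> eH zb ze we; apply/bigcupP; exists z => //.
by apply/setUP; right; apply/bigcupP; exists e; rewrite ?inE ?eH.
Qed.

Lemma ball_mono n (H : hypergraph n) (k k' : nat) (u : 'I_n) :
  k <= k' -> ball H k u \subset ball H k' u.
Proof.
elim: k' => [|k' IHk']; first by rewrite leqn0 => /eqP->.
rewrite leq_eqVlt => /predU1P[->//|/IHk' sub].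
apply: subset_trans sub _; apply/subsetP => w wb.
by apply/bigcupP; exists w => //; rewrite !inE eqxx.
Qed.

(** * Invariant of the reachable states *)

(** The second clause recovers the graph from [s.2], so unavailability can be read off the
    hypergraph alone. *)
Definition valid (r l n : nat) (s : state n) : Prop :=
  [/\ forall f, f \in s.2 -> #|f| = r,
      s.1 = [set p : {set 'I_n} | (#|p| == 2) && [forall f in s.2, ~~ (p \subset f)]]
    & forall j, 3 <= j <= l -> ~~ contains_linear_cycle r j s.2].

Lemma valid_init r l n : valid r l (init_state n).
Proof.
split=> [f||j /andP[j3 _]]; first by rewrite inE.
- apply/setP => p; rewrite !inE subsetT /=; case: (_ == 2) => //=.
  by apply/esym/forall_inP => f; rewrite inE.
- apply/existsPn => e; rewrite !negb_and; apply/orP; left.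
  by apply/forallPn; exists (Ordinal (ltnW (ltnW j3))); rewrite inE.
Qed.

(** As [1 < r], an edge of [s.2] contains a pair, and that pair is no longer in [s.1]. Hence each
    step adds exactly one new edge. *)
Lemma available_notin r l n (s : state n) e :
  1 < r -> valid r l s -> e \in available r l s -> e \notin s.2.
Proof.
move=> r1 [Hr G _]; rewrite inE => /and3P[/eqP er sub _]; apply/negP => eH.
have [x [y [xe ye xy]]] : exists x y, [/\ x \in e, y \in e & x != y].
  by apply/card_gt1P; rewrite er.
have pe : [set x; y] \subset e by rewrite subUset !sub1set xe ye.
have: [set x; y] \in s.1 by apply: (subsetP sub); rewrite inE pe cards2 xy.
by rewrite G inE => /andP[_ /forall_inP/(_ _ eH)]; rewrite pe.
Qed.

Lemma valid_next r l n (s : state n) e :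
  valid r l s -> e \in available r l s -> valid r l (next_state s e).
Proof.
move=> [Hr G _]; rewrite inE => /and3P[/eqP er sub /forallP cyc].
split=> /= [f||j /andP[j3 jl]].
- by rewrite !inE => /predU1P[->|/Hr].
- apply/setP => p; rewrite G !inE; case: (_ == 2); rewrite ?andbF //= andbT.
  apply/andP/forall_inP => [[pe /forall_inP pH] f|pH].
    by rewrite !inE => /predU1P[->//|/pH].
  split; first by apply: pH; rewrite setU11.
  by apply/forall_inP => f fH; apply: pH; rewrite setU1r.
- have jl' : j < l.+1 by [].
  by have /implyP/(_ j3) := cyc (Ordinal jl').
Qed.

(** A cycle absent from [H] must use [f]; its other [j.-1] edges form a path that leaves [f] at [u]
    and returns to it at [v]. The delicate point is [u != v]. *)
Lemma linear_cycle_ball r j n (H : hypergraph n) (f : {set 'I_n}) :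
  1 < r -> 3 <= j -> ~~ contains_linear_cycle r j H ->
  contains_linear_cycle r j (f |: H) ->
  exists u v, [/\ u \in f, v \in f, u != v & v \in ball H j.-1 u].
Proof.
move=> r1 j3 noH /existsP[e /and3P[/forallP eH /forallP eI eU]].
have j0 : 0 < j by lia.
have adj a b : a != b -> #|e a :&: e b| = cyc_adj a b.
  by move=> ab; have /forallP/(_ b)/implyP/(_ ab)/eqP := eI a.
have er a : #|e a| = r by have /andP[_ /eqP] := eH a.
have e_inj a b : a != b -> e a != e b.
  move=> ab; apply/eqP => eab; have := adj _ _ ab.
  by rewrite -eab setIid er; case: cyc_adj; lia.
have [a ea] : exists a, e a = f.
  apply/exists_eqP; apply: contraNT noH => /existsPn ne; apply/existsP; exists e.
  rewrite eU andbT; apply/andP; split; last exact/forallP.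
  apply/forallP => a; rewrite er eqxx andbT.
  by have /andP[/setU1P[/eqP h|//]] := eH a; move: (ne a); rewrite h.
(* Cyclic numbering starting at [f]: [b 0] and [b j] are both the index of [f], and the indices in
   between give edges of [H]. *)
pose b k : 'I_j := Ordinal (ltn_pmod (a + k) j0).
have b0 : b 0 = a by apply: val_inj; rewrite /= addn0 modn_small.
have bj : b j = a by apply: val_inj; rewrite /= modnDr modn_small.
have b_inj k k' : k < j -> k' < j -> b k = b k' -> k = k'.
  move=> kj k'j /(congr1 val)/= /eqP.
  by rewrite eqn_modDl !modn_small // => /eqP.
have ebH k : 0 < k < j -> e (b k) \in H.
  move=> /andP[k0 kj]; have /andP[/setU1P[h|//] _] := eH (b k).
  suff /eqP bk : b k == b 0 by have := b_inj _ _ kj j0 bk; lia.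
  by apply: contraT => /e_inj; rewrite b0 ea h eqxx.
have bS k : k < j -> exists z, z \in e (b k) :&: e (b k.+1).
  move=> kj; apply/set0Pn; rewrite -cards_eq0 adj.
    by rewrite /cyc_adj /= modn_mod -[((a + k) %% j).+1]addn1 modnDml addn1 addnS eqxx.
  apply/eqP => /(congr1 val)/= /eqP.
  by rewrite addnS -addn1 -{1}[a + k]addn0 eqn_modDl mod0n modn_small //; lia.
have [u] := bS 0 j0; rewrite b0 ea => /setIP[uf ub1].
(* Along the path, each edge costs one unit of radius. *)
have bK k : 0 < k < j -> e (b k) \subset ball H k u.
  elim: k => // k IHk kj; apply/subsetP => w wb.
  have [k0|k0] := posnP k.
    subst k; apply: (ball_step (z := u)) ub1 wb; first exact: ebH.
    by rewrite /ball /= inE.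
  have [|z /setIP[z1 z2]] := bS k; first lia.
  apply: (ball_step (z := z)) z2 wb; first exact: ebH.
  by apply: (subsetP (IHk _)); first lia.
have [|v] := bS j.-1; first lia.
rewrite prednK // bj ea => /setIP[vb vf].
exists u, v; split=> //; last by apply: (subsetP (bK j.-1 _)); first lia.
(* If [u = v], then for [j >= 4] the disjoint edges [b 1] and [b j.-1] meet, and
   for [j = 3] three edges through [u] span [3 r - 2 > (r - 1) * 3] vertices. *)
apply/eqP => uv; subst v.
have b1j : b 1 != b j.-1 by apply/eqP => /b_inj; lia.
have uI : u \in e (b 1) :&: e (b j.-1) by rewrite inE ub1.
have [j4|j4] := leqP 4 j.
  have : 0 < #|e (b 1) :&: e (b j.-1)| by apply/card_gt0P; exists u.
  rewrite adj // /cyc_adj /= !modn_mod -!(addn1 (_ %% _)) !modnDml -!addnA.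
  rewrite !eqn_modDl [j.-1 + 1]addn1 prednK // modnn !modn_small; lia.
have {j4} je : j = 3 by lia.
have all_u c : u \in e c.
  suff [k kj ->] : exists2 k, k < j & c = b k.
    have [->|[->|->]] : k = 0 \/ k = 1 \/ k = j.-1 by lia.
    - by rewrite b0 ea.
    - exact: ub1.
    - exact: vb.
  exists ((c + (j - a)) %% j); first by rewrite ltn_mod.
  apply: val_inj => /=; have aj := ltn_ord a.
  by rewrite modnDmr addnCA subnKC 1?ltnW // modnDr modn_small.
move: eU; clear -je all_u adj er r1; subst j.
have card1 (c d : 'I_3) : c != d -> #|e c :&: e d| <= 1.
  by move=> cd; rewrite adj // leq_b1.
have eq1 (c d : 'I_3) : c != d -> e c :&: e d = [set u].
  move=> cd; apply/esym/eqP; rewrite eqEcard cards1 card1 // andbT.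
  by rewrite sub1set inE !all_u.
rewrite !big_ord_recl big_ord0 setU0 !cardsU setIUr !eq1 // setUid !cards1 !er.
lia.
Qed.

(** Either a pair of [f] is covered by an edge, giving distance 1, or [f] closes a cycle of length
    [j <= l], giving distance at most [j.-1]. *)
Lemma unavailable_ball r l n (s : state n) (f : {set 'I_n}) :
  1 < r -> 2 < l -> valid r l s -> #|f| = r -> f \notin available r l s ->
  exists u v, [/\ u \in f, v \in f, u != v & v \in ball s.2 l.-1 u].
Proof.
move=> r1 l2 [Hr G cyc] fr; rewrite inE fr eqxx /= negb_and.
case/orP => [/subsetPn[p]|/forallPn[j]].
  rewrite inE => /andP[pf /cards2P[u [v [uv pE]]]]; rewrite G inE pE cards2 uv /=.
  case/forall_inPn => e eH; rewrite negbK => /subsetP pe.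
  exists u, v; split=> //; try by apply: (subsetP pf); rewrite pE !inE eqxx ?orbT.
  apply: (subsetP (ball_mono _ _ (_ : 1 <= _))); first lia.
  apply: (ball_step (e := e) (z := u)) => //; rewrite ?pe ?inE ?eqxx ?orbT //.
rewrite negb_imply negbK => /andP[j3 h].
have jl := ltn_ord j; have /(linear_cycle_ball r1 j3) : ~~ contains_linear_cycle r j s.2.
  by apply: cyc; rewrite j3.
move=> /(_ f h)[u [v [uf vf uv vb]]]; exists u, v; split=> //.
by apply: (subsetP (ball_mono _ _ _)) vb; lia.
Qed.

(** * Counting available sets *)

Lemma card_supersets n r (A : {set 'I_n}) :
  #|[set f : {set 'I_n} | (A \subset f) && (#|f| == r)]| <= 'C(n - #|A|, r - #|A|).
Proof.
have -> : n - #|A| = #|~: A| by rewrite [RHS]cardsCs setCK card_ord.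
rewrite -cards_draws -(card_in_imset (f := fun f => f :\: A)).
  apply/subset_leq_card/subsetP => _ /imsetP[f + ->].
  rewrite !inE => /andP[Af /eqP fr].
  by rewrite setDE subsetIr -setDE cardsD (setIidPr Af) fr eqxx.
move=> f g; rewrite !inE => /andP[/setIidPr Af _] /andP[/setIidPr Ag _] /= fg.
by rewrite -(setID f A) -(setID g A) fg Af Ag.
Qed.

(** Union bound over ordered pairs of distinct vertices at distance at most [l.-1]: balls bound
    their number, and each pair lies in at most ['C(n - 2, r - 2)] sets of size [r]. *)
Lemma card_unavailable r l n D (s : state n) :
  1 < r -> 2 < l -> valid r l s -> (forall v, deg s.2 v <= D) ->
  'C(n, r) <= #|available r l s| + n * (1 + D * r) ^ l.-1 * 'C(n - 2, r - 2).
Proof.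
move=> r1 l2 vs dD.
set K := (1 + D * r) ^ l.-1.
pose P := \bigcup_(u in [set: 'I_n]) [set (u, v) | v in ball s.2 l.-1 u :\ u].
have cP : #|P| <= n * K.
  rewrite -[n in n * _]card_ord -cardsT; apply: card_bigcup_le => u _.
  apply: leq_trans (leq_imset_card _ _) _.
  apply: leq_trans (subset_leq_card (subsetDl _ _)) _.
  by apply: card_ball => //; case: vs.
pose S (p : 'I_n * 'I_n) :=
  [set f : {set 'I_n} | ([set p.1; p.2] \subset f) && (#|f| == r)].
have cS : #|\bigcup_(p in P) S p| <= #|P| * 'C(n - 2, r - 2).
  apply: card_bigcup_le => p /bigcupP[u _ /imsetP[v]].
  rewrite !inE => /andP[vu _] ->.
  by have := card_supersets r [set u; v]; rewrite cards2 eq_sym vu.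
have -> : 'C(n, r) = #|[set f : {set 'I_n} | #|f| == r]|.
  by rewrite card_draws card_ord.
apply: leq_trans (leq_add (leqnn _) (leq_trans cS (leq_mul cP (leqnn _)))).
apply: leq_trans (leq_card_setU _ _); apply/subset_leq_card/subsetP => f.
rewrite inE => /eqP fr; apply/setUP.
have [|fQ] := boolP (f \in available r l s); first by left.
right; have [u [v [uf vf uv vb]]] := unavailable_ball r1 l2 vs fr fQ.
apply/bigcupP; exists (u, v); last by rewrite inE subUset !sub1set uf vf fr eqxx.
by apply/bigcupP; exists u; rewrite ?inE // imset_f // !inE eq_sym uv.
Qed.

(** Since [r * r.-1 * 'C(n, r) = n * n.-1 * 'C(n - 2, r - 2)], the hypothesis makes the error term
    of [card_unavailable] at most half of ['C(n, r)]. *)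
Lemma available_half r l n D (s : state n) :
  1 < r -> 2 < l -> valid r l s -> (forall v, deg s.2 v <= D) ->
  2 * (r * r.-1) * (1 + D * r) ^ l.-1 <= n.-1 -> 'C(n, r) <= 2 * #|available r l s|.
Proof.
move=> r1 l2 vs dD hD; have := card_unavailable r1 l2 vs dD.
move: hD; set X := (1 + _) ^ _; set Q := #|_| => hD.
have c1 : n * 'C(n.-1, r.-1) = r * 'C(n, r).
  by case: r r1 {vs X Q hD dD} => // r _; exact: mul_bin_diag.
have c2 : n.-1 * 'C(n - 2, r - 2) = r.-1 * 'C(n.-1, r.-1).
  rewrite !subn2; case: r r1 {c1 vs X Q hD dD} => [|[|r]] // _; exact: mul_bin_diag.
move: c1 c2; set a := 'C(n, r); set b := 'C(_, _); set c := 'C(_, _) => c1 c2.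
move=> aQ; have: 2 * (r * r.-1) * (n * X * c) <= r * r.-1 * a.
  have -> : r * r.-1 * a = n * c * n.-1.
    by rewrite mulnAC -c1 -mulnA [b * _]mulnC -c2; lia.
  by apply: leq_trans (leq_mul (leqnn (n * c)) hD); lia.
rewrite -mulnA mulnCA leq_pmul2l; last by lia.
lia.
Qed.

(** Combined with [available_half], this bounds by [2 * r / n] the probability that a step hits
    [v]. *)
Lemma card_available_at r l n (s : state n) (v : 'I_n) :
  0 < r -> n * #|[set e in available r l s | v \in e]| <= r * 'C(n, r).
Proof.
move=> r0; have <- : n * 'C(n.-1, r.-1) = r * 'C(n, r).
  by case: r r0 => // r _; exact: mul_bin_diag.
rewrite leq_mul2l; apply/orP; right; have := card_supersets r [set v].
rewrite cards1 !subn1; apply: leq_trans; apply/subset_leq_card/subsetP => f.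
by rewrite !inE sub1set => /andP[/and3P[-> _ _] ->].
Qed.

Local Open Scope ring_scope.

(** * One-step expectations and supermartingales *)

Definition expect (R : realFieldType) r l n (s : state n) (h : state n -> R) : R :=
  \sum_t transition R r l s t * h t.

Lemma sum_dirac (R : realFieldType) n (u : state n) (h : state n -> R) :
  \sum_t (t == u)%:R * h t = h u.
Proof.
rewrite (bigD1 u) //= eqxx mul1r big1 ?addr0 // => t /negPf->.
by rewrite mul0r.
Qed.

Lemma expect_terminated (R : realFieldType) r l n (s : state n) (h : state n -> R) :
  terminated r l s -> expect r l s h = h s.
Proof. by move=> ts; rewrite /expect /transition ts sum_dirac. Qed.

Lemma expect_next (R : realFieldType) r l n (s : state n) (h : state n -> R) :
  ~~ terminated r l s ->
  expect r l s h =
    (\sum_(e in available r l s) h (next_state s e)) / #|available r l s|%:R.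
Proof.
move=> /negPf ts; rewrite /expect /transition ts.
under eq_bigr do rewrite mulr_suml.
rewrite exchange_big /= mulr_suml; apply: eq_bigr => e _.
rewrite -(sum_dirac _ h) mulr_suml; apply: eq_bigr => t _.
by rewrite mulrAC.
Qed.

Lemma law_valid (R : realFieldType) r l n i (s : state n) :
  law R r l i s != 0 -> valid r l s.
Proof.
elim: i s => [|i IHi] s /=.
  by case: (s =P _) => [->|_]; rewrite ?eqxx // => _; exact: valid_init.
have sum_neq0 (T : finType) (P : pred T) (F : T -> R) :
    \sum_(x | P x) F x != 0 -> exists2 x, P x & F x != 0.
  move=> S0; case: (pickP (fun x => P x && (F x != 0))) => [x /andP[]|F0].
    by exists x.
  case/eqP: S0; apply: big1 => x Px; apply/eqP; move: (F0 x).
  by rewrite Px => /negbFE.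
move=> /sum_neq0[u _]; rewrite mulf_eq0 negb_or => /andP[/IHi vu].
rewrite /transition; case: ifP => _.
  by case: (s =P u) => [->|]; rewrite ?eqxx.
move=> /sum_neq0[e eQ]; case: (s =P _) => [-> _|_]; last by rewrite mul0r eqxx.
exact: valid_next.
Qed.

(** The one-step inequality is asked at valid states, which carry the whole mass by [law_valid]; it
    is then averaged one transition at a time. *)
Lemma supermartingale_law (R : realFieldType) r l n i (h : state n -> R) :
  (forall s, valid r l s -> expect r l s h <= h s) ->
  \sum_s law R r l i s * h s <= h (init_state n).
Proof.
move=> hE; elim: i => [|i IHi] /=; first by rewrite sum_dirac.
apply: le_trans IHi; under eq_bigr do rewrite mulr_suml.
rewrite exchange_big /=; apply: ler_sum => s _.
under eq_bigr do rewrite -mulrA.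
rewrite -mulr_sumr -/(expect r l s h).
have [->|/law_valid vs] := eqVneq (law R r l i s) 0; first by rewrite !mul0r.
by rewrite ler_wpM2l ?law_ge0 // hE.
Qed.

(** * The exponential degree potential *)

Definition exp_deg (R : realFieldType) (b : R) n (H : hypergraph n) : R :=
  \sum_v b ^+ deg H v.

Lemma deg_setU1 n (H : hypergraph n) e v :
  e \notin H -> deg (e |: H) v = (deg H v + (v \in e))%N.
Proof.
move=> eH; rewrite /deg.
have -> : [set f in e |: H | v \in f] =
    if v \in e then e |: [set f in H | v \in f] else [set f in H | v \in f].
  apply/setP => f; case: ifP => ve; rewrite !inE;
  by have [->|] := eqVneq f e; rewrite ?ve ?andbF.
case: ifP => ve; last by rewrite addn0.
by rewrite cardsU1 inE (negPf eH) addnC.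
Qed.

(** The term of [v] is multiplied by [b] when the new edge contains [v], that is by
    [1 + (b - 1) * (v \in e)], and this event has probability at most [2 * r / n]. *)
Lemma expect_exp_deg (R : realFieldType) (b : R) r l n (s : state n) :
  1 <= b -> (1 < r <= n)%N -> valid r l s -> ('C(n, r) <= 2 * #|available r l s|)%N ->
  expect r l s (fun t => exp_deg b t.2) <=
    exp_deg b s.2 * (1 + (b - 1) * (2 * r%:R / n%:R)).
Proof.
move=> b1 /andP[r1 rn] vs Q2.
have n0 : (0 < n%:R :> R) by rewrite ltr0n; lia.
have Q0 : (0 < #|available r l s|)%N by move: rn; rewrite -bin_gt0; lia.
have nts : ~~ terminated r l s by rewrite /terminated -cards_eq0 -lt0n.
rewrite expect_next // ler_pdivrMr ?ltr0n // /exp_deg.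
rewrite exchange_big /= mulr_suml mulr_suml; apply: ler_sum => v _.
rewrite (eq_bigr (fun e : {set 'I_n} =>
    b ^+ deg s.2 v * (1 + (b - 1) * (v \in e)%:R))); last first.
  move=> e eQ; rewrite deg_setU1 ?exprD; last exact: available_notin eQ.
  by congr (_ * _); case: (v \in e); rewrite ?(mulr1, mulr0, addr0) // addrC subrK.
rewrite -mulr_sumr -[leRHS]mulrA ler_wpM2l ?exprn_ge0 //; first by lra.
rewrite big_split /= sumr_const -mulr_sumr [leRHS]mulrDl mul1r lerD2l -[leRHS]mulrA.
rewrite ler_wpM2l ?subr_ge0 // -natr_sum.
rewrite mulrAC ler_pdivlMr // -!natrM ler_nat.
have -> : (\sum_(e in available r l s) (v \in e))%N =
    #|[set e in available r l s | v \in e]|.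
  rewrite -sum1dep_card [RHS]big_mkcondr; apply: eq_bigr => e _.
  by case: (v \in e).
rewrite mulnC; apply: leq_trans (card_available_at l s v (ltnW r1)) _.
by rewrite -mulnA mulnCA leq_mul.
Qed.

(* The stopped potential: once a degree exceeds [D] it is frozen at 1, which
   makes its expectation an upper bound for the probability of stopping early. *)
Definition potential (R : realFieldType) (b q : R) (D m n : nat) (s : state n) : R :=
  if (m <= #|s.2|)%N then 0
  else if [exists v, (D < deg s.2 v)%N] then 1
  else exp_deg b s.2 * q ^+ (m - #|s.2|) / b ^+ D.

Section Potential.

Variables (R : realFieldType) (b : R) (r l n D m : nat).
Hypotheses (b1 : 1 <= b) (r1 : (1 < r <= n)%N) (l2 : (2 < l)%N).
Hypothesis hD : (2 * (r * r.-1) * (1 + D * r) ^ l.-1 <= n.-1)%N.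

Let q := 1 + (b - 1) * (2 * r%:R / n%:R).

Let q1 : 1 <= q.
Proof.
by rewrite lerDl mulr_ge0 ?subr_ge0 // divr_ge0 // mulr_ge0 // ler0n.
Qed.

Let b_gt0 : 0 < b. Proof. exact: lt_le_trans b1. Qed.

Lemma exp_deg_ge0 (H : hypergraph n) : 0 <= exp_deg b H.
Proof. by apply: sumr_ge0 => v _; rewrite exprn_ge0 // ltW. Qed.

Lemma potential_ge0 (s : state n) : 0 <= potential b q D m s.
Proof.
rewrite /potential; do 2 (case: ifP => // _).
by rewrite divr_ge0 ?mulr_ge0 ?exprn_ge0 ?exp_deg_ge0 // ltW // (lt_le_trans _ q1).
Qed.

(** Freezing never raises the value: a vertex of degree above [D] alone contributes at least
    [b ^+ D] to [exp_deg]. *)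
Lemma potential_le (s : state n) :
  potential b q D m s <= exp_deg b s.2 * q ^+ (m - #|s.2|) / b ^+ D.
Proof.
have q0 : 0 <= q by exact: le_trans q1.
rewrite /potential; case: ifP => _.
  by rewrite divr_ge0 ?mulr_ge0 ?exprn_ge0 ?exp_deg_ge0 // ltW.
case: ifPn => // /existsP[v dv]; rewrite ler_pdivlMr ?exprn_gt0 // mul1r.
rewrite -[leLHS]mulr1 ler_pM ?exprn_ge0 ?exprn_ege1 //; first exact: ltW.
rewrite /exp_deg (bigD1 v) //= -[leLHS]addr0 lerD ?ler_weXn2l // ?(ltnW dv) //.
by apply: sumr_ge0 => w _; rewrite exprn_ge0 // ltW.
Qed.

Lemma small_deg_available (s : state n) : valid r l s ->
  ~~ [exists v, (D < deg s.2 v)%N] -> ('C(n, r) <= 2 * #|available r l s|)%N.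
Proof.
move=> vs /existsPn dD; apply: (available_half _ l2 vs (D := D)) => //.
  by case/andP: r1.
by move=> v; rewrite leqNgt.
Qed.

(** If all degrees were at most [D], half of the [r]-sets would be available; so a run that ends
    early is frozen. *)
Lemma potential_terminated (s : state n) : valid r l s -> terminated r l s ->
  (#|s.2| < m)%N -> potential b q D m s = 1.
Proof.
move=> vs ts sm; rewrite /potential leqNgt sm /=; case: ifPn => // /small_deg_available.
move=> /(_ vs); rewrite (eqP ts) cards0 muln0 leqn0 => /eqP C0.
by case/andP: r1 => _; rewrite -bin_gt0 C0.
Qed.

(** The factor [q ^+ (m - #|s.2|)] loses one [q] per new edge, which offsets the growth of
    [exp_deg]. *)
Lemma expect_potential (s : state n) : valid r l s ->
  expect r l s (@potential R b q D m n) <= potential b q D m s.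
Proof.
move=> vs; have [ts|nts] := boolP (terminated r l s).
  by rewrite expect_terminated.
have Q0 : (0 < #|available r l s|)%N by rewrite lt0n cards_eq0.
have r2 : (1 < r)%N by case/andP: r1.
have cardS e : e \in available r l s -> #|(next_state s e).2| = #|s.2|.+1.
  by move=> eQ; rewrite cardsU1 (available_notin r2 vs eQ).
rewrite expect_next // ler_pdivrMr ?ltr0n //.
have sum_le c : (forall e, e \in available r l s -> potential b q D m (next_state s e) <= c) ->
    \sum_(e in available r l s) potential b q D m (next_state s e)
      <= c * #|available r l s|%:R.
  by move=> hc; apply: le_trans (ler_sum _ hc) _; rewrite sumr_const mulr_natr.
rewrite {2}/potential; case: ifPn => [ms|].
  by apply: sum_le => e eQ; rewrite /potential cardS // leqW.
rewrite -ltnNge => sm; case: ifPn => [/existsP[v dv]|small].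
  (* Degrees never decrease, so a frozen state stays frozen unless it reaches [m] edges, where the
     potential is 0. *)
  apply: sum_le => e eQ; rewrite /potential; case: ifP => // _.
  case: ifPn => // /existsPn/(_ v)/negP[].
  by rewrite deg_setU1 ?(available_notin r2 vs eQ) // ltn_addr.
(* The successor may freeze or reach [m] edges; [potential_le] covers every case at once. *)
apply: (@le_trans _ _ (\sum_(e in available r l s)
    exp_deg b (next_state s e).2 * (q ^+ (m - #|s.2|.+1) / b ^+ D))).
  apply: ler_sum => e eQ; rewrite mulrA -(cardS e) //; exact: potential_le.
have := expect_exp_deg b1 r1 vs (small_deg_available vs small).
rewrite expect_next // ler_pdivrMr ?ltr0n // -mulr_suml -/q => hE.
rewrite -(subnSK sm) exprS.
have q0 : 0 <= q by exact: le_trans q1.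
have c0 : 0 <= q ^+ (m - #|s.2|.+1) / b ^+ D.
  by rewrite divr_ge0 ?exprn_ge0 // ltW.
apply: le_trans (ler_wpM2r c0 hE) _.
have alg (p t Q c d : R) : p * t * Q * (c / d) = p * (t * c) / d * Q by ring.
by rewrite alg.
Qed.

(** Markov's inequality: a final state with fewer than [m] edges has potential 1, so the failure
    probability is at most the initial potential, where all degrees are 0. *)
Lemma prob_final_edges_lb (x : R) : x <= m%:R ->
  1 - n%:R * q ^+ m / b ^+ D <= prob_final_edges_ge r l n x.
Proof.
move=> xm; rewrite lerBlDr -[leLHS](law_sum1 R r l n 'C(n, r)).
rewrite (bigID (fun s : state n => terminated r l s && (x <= #|s.2|%:R))) /=.
rewrite lerD2l.
have init : potential b q D m (init_state n) <= n%:R * q ^+ m / b ^+ D.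
  apply: le_trans (potential_le _) _; rewrite /= cards0 subn0 /exp_deg.
  rewrite (eq_bigr (fun=> 1)) ?sumr_const ?card_ord // => v _.
  by rewrite (_ : deg _ _ = 0%N) ?expr0 //; apply: eq_card0 => e; rewrite !inE.
apply: le_trans (le_trans (supermartingale_law 'C(n, r) expect_potential) init).
rewrite [leLHS]big_mkcond; apply: ler_sum => s _.
case: ifPn => [|_]; last by rewrite mulr_ge0 ?law_ge0 ?potential_ge0.
have [->|ls] := eqVneq (law R r l 'C(n, r) s) 0; first by rewrite mul0r.
have r2 : (1 < r)%N by case/andP: r1.
have ts := law_terminated r2 ls; rewrite ts /= -ltNge => sx.
rewrite potential_terminated ?mulr1 //; first exact: law_valid ls.
by rewrite -(ltr_nat R); exact: lt_le_trans xm.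
Qed.

End Potential.

From mathcomp Require Import all_classical all_reals all_analysis.

Import numFieldNormedType.Exports.

Local Open Scope classical_set_scope.
Local Open Scope ring_scope.

Lemma prob_final_edges_ge_le1 (R : realFieldType) r l n (x : R) :
  prob_final_edges_ge r l n x <= 1.
Proof.
rewrite -(law_sum1 R r l n 'C(n, r)) /prob_final_edges_ge [leLHS]big_mkcond.
by apply: ler_sum => s _; case: ifP => // _; exact: law_ge0.
Qed.

(** * Numerical estimates *)

(** The cubic term of the exponential suffices: [(y / k) ^+ 3 / 6 >= 6 * y ^+ 2] as soon as
    [y >= 36 * k ^+ 3]. *)
Lemma expR_ge_quadratic (R : realType) (k : nat) (y : R) :
  (0 < k)%N -> 36 * k%:R ^+ 3 <= y -> 6 * y ^+ 2 <= expR (y / k%:R).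
Proof.
move=> k0 yk; have k3 : 1 <= k%:R ^+ 3 :> R by rewrite exprn_ege1 // ler1n.
have y0 : 0 < y by lra.
apply: (@le_trans _ _ ((y / k%:R) ^+ 3 / 6)).
  rewrite expr_div_n -mulrA -invfM ler_pdivlMr ?mulr_gt0 ?exprn_gt0 ?ltr0n //.
  rewrite [y ^+ 3]exprSr [_ ^+ 2 * y]mulrC.
  have := ler_wpM2r (exprn_ge0 2 (ltW y0)) yk; lra.
have := @expR_ge1Dxn R (y / k%:R) 2 (divr_ge0 (ltW y0) (ler0n _ k)).
by rewrite (_ : 3`!%:R = 6 :> R) //; lra.
Qed.

(** By [1 + t <= expR t], the exponent of the left side is at most [y + m * K / n - D]. Since [D] is
    nearly [N / y] and [m * K / n] is about half of that at most, the remaining [N / (2 * y)] brings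
    it below [- y]. *)
Lemma prob_failure_le (R : realType) (r k n : nat) (y := ln n%:R : R)
    (N := expR (y / k%:R)) (K := (expR 1 - 1) * (2 * r%:R) : R) (D m : nat) :
  (0 < k)%N -> (2 <= n)%N -> 36 * k%:R ^+ 3 <= y -> 2 * K + 1 <= y ->
  N / y < D.+1%:R -> m%:R <= n%:R * N / y ^+ 2 + 1 ->
  n%:R * (1 + (expR 1 - 1) * (2 * r%:R / n%:R)) ^+ m / expR 1 ^+ D <= n%:R^-1 :> R.
Proof.
move=> k0 n2 yk yK hD hm.
have k1 : 1 <= k%:R :> R by rewrite ler1n.
have n0 : 0 < n%:R :> R by rewrite ltr0n; lia.
have n1 : 1 <= n%:R :> R by rewrite ler1n; lia.
have k3 : 1 <= k%:R ^+ 3 :> R by rewrite exprn_ege1.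
have y1 : 1 <= y by lra.
have y0 : 0 < y by lra.
have K0 : 0 <= K.
  by rewrite mulr_ge0 ?mulr_ge0 ?ler0n // subr_ge0 ltW // expR_gt1.
have Ny : 6 * y ^+ 2 <= N by exact: expR_ge_quadratic.
have En : n%:R = expR y by rewrite lnK // posrE.
have qm : (1 + (expR 1 - 1) * (2 * r%:R / n%:R)) ^+ m <= expR (m%:R * (K / n%:R)) :> R.
  rewrite expRM_natl; apply: lerXn2r; rewrite ?nnegrE ?expR_ge0 //.
  by apply: le_trans (expR_ge1Dx _); rewrite /K -!mulrA.
rewrite -expRM_natl mulr1 -expRN.
apply: (@le_trans _ _ (n%:R * expR (m%:R * (K / n%:R)) * expR (- D%:R))).
  by rewrite ler_wpM2r ?expR_ge0 // ler_wpM2l // ltW.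
(* The bound [2 * K <= y] halves the main term; the [+ 1] from rounding [m] up costs at most [K]. *)
have mK : m%:R * (K / n%:R) <= N / (2 * y) + K.
  apply: (@le_trans _ _ ((n%:R * N / y ^+ 2 + 1) * (K / n%:R))).
    by rewrite ler_wpM2r // divr_ge0 // ltW.
  rewrite mulrDl mul1r lerD //; last by rewrite ler_pdivrMr // ler_peMr.
  have -> : n%:R * N / y ^+ 2 * (K / n%:R) = N / (2 * y) * (2 * K / y).
    by field; rewrite !gt_eqF.
  rewrite -[leRHS]mulr1 ler_wpM2l ?divr_ge0 ?expR_ge0 //; first by lra.
  by rewrite ler_pdivrMr // mul1r; lra.
move: mK; set c := m%:R * _ => mK; rewrite En -expRN -!expRD ler_expR.
have N2 : 3 * y <= N / (2 * y).
  rewrite ler_pdivlMr; last by lra.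
  by move: Ny; rewrite expr2; lra.
have Ny2 : N / y = N / (2 * y) *+ 2 by field; rewrite gt_eqF.
move: hD; rewrite Ny2 -natr1 mulr2n => hD.
move: (N / (2 * y)) hD mK N2 => A hD mK N2.
clear -hD mK N2 yK K0; clearbody c K y; lra.
Qed.

(** Here [N ^+ k = n], so [(1 + D * r) ^ k] is at most [(r + 1) ^+ k * n / y ^+ k]. One power of [y]
    absorbs the constants, and the left side is at most [n / 2], hence at most [n.-1]. *)
Lemma deg_bound_le (R : realType) (r k n : nat) (y := ln n%:R : R)
    (N := expR (y / k%:R)) (D : nat) :
  (0 < k)%N -> (0 < r)%N -> (2 <= n)%N -> 4 * r%:R ^+ 2 * (r%:R + 1) ^+ k <= y ->
  y <= N -> D%:R <= N / y -> (2 * (r * r.-1) * (1 + D * r) ^ k <= n.-1)%N.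
Proof.
move=> k0 r0 n2 yr yN DN.
have r1 : 1 <= r%:R :> R by rewrite ler1n.
have n0 : 0 < n%:R :> R by rewrite ltr0n; lia.
have rk1 : 1 <= (r%:R + 1) ^+ k :> R by rewrite exprn_ege1 //; lra.
have r21 : 1 <= r%:R ^+ 2 :> R by rewrite exprn_ege1.
have y1 : 1 <= y by apply: le_trans yr; nra.
have y0 : 0 < y by lra.
have Ny1 : 1 <= N / y by rewrite ler_pdivlMr // mul1r.
have En : N ^+ k = n%:R.
  by rewrite -expRM_natl mulrC divfK ?lnK ?posrE // pnatr_eq0 -lt0n.
rewrite -(ler_nat R) !natrM natrX natrD natrM -[n.-1]subn1 natrB; last by lia.
apply: (@le_trans _ _ (2 * r%:R ^+ 2 * ((r%:R + 1) * (N / y)) ^+ k)).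
  apply: ler_pM.
  - by rewrite !mulr_ge0 ?ler0n.
  - by rewrite exprn_ge0 // addr_ge0 // mulr_ge0.
  - by rewrite ler_wpM2l // expr2 ler_wpM2l // ler_nat leq_pred.
  - apply: lerXn2r; rewrite ?nnegrE.
    + by rewrite addr_ge0 // mulr_ge0.
    + by rewrite mulr_ge0 //; lra.
    rewrite mulrDl mul1r addrC lerD // mulrC ler_wpM2l //; lra.
rewrite exprMn expr_div_n En.
have yk : y <= y ^+ k by rewrite -[leLHS]expr1 ler_weXn2l.
have yk0 : 0 < y ^+ k by rewrite exprn_gt0.
have -> : 2 * r%:R ^+ 2 * ((r%:R + 1) ^+ k * (n%:R / y ^+ k)) =
    (4 * r%:R ^+ 2 * (r%:R + 1) ^+ k / y ^+ k) * (n%:R / 2) :> R.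
  by field; rewrite gt_eqF.
apply: (@le_trans _ _ (1 * (n%:R / 2))).
  rewrite ler_wpM2r ?divr_ge0 // ler_pdivrMr // mul1r; exact: le_trans yk.
have : 2 <= n%:R :> R by rewrite ler_nat.
by lra.
Qed.

(** As [n = expR y], raising [n] to the power [ln y / y] gives [y]. *)
Lemma powR_threshold (R : realType) (k n : nat) (y := ln n%:R : R) :
  (0 < n)%N -> 0 < y ->
  n%:R `^ (1 + 1 / k%:R - 2 * (ln y / y)) = n%:R * expR (y / k%:R) / y ^+ 2.
Proof.
move=> n0 y0; have n0' : 0 < n%:R :> R by rewrite ltr0n.
have En : expR y = n%:R by rewrite lnK // posrE.
rewrite /powR gt_eqF // -/y mulrBl mulrDl !mul1r expRD expRD En [k%:R^-1 * y]mulrC.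
congr (_ * _); rewrite expRN; congr (_ ^-1).
have -> : 2 * (ln y / y) * y = 2%:R * ln y by field; rewrite gt_eqF.
by rewrite expRM_natl lnK.
Qed.

(** * Choice of parameters and passage to the limit *)

Theorem theorem1p1 (R : realType) (l : nat) (hl : (3 <= l)%N) :
  exists lambda : R, 0 < lambda /\
    forall r : nat, (3 <= r)%N ->
      (fun n : nat =>
         prob_final_edges_ge r l n
           (n%:R `^ (1 + 1 / (l%:R - 1)
                     - lambda * (ln (ln n%:R) / ln n%:R)))) @ \oo --> (1 : R).
Proof.
(* The value 2 yields the factor [y ^+ 2]: one [y] is lost in [D], the other makes the growth
   [q ^+ m] negligible against [expR 1 ^+ D]. *)
exists 2; split=> // r r3; set k := l.-1.
have -> : l%:R - 1 = k%:R :> R by rewrite /k -subn1 natrB //; lia.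
have k0 : (0 < k)%N by lia.
pose K : R := (expR 1 - 1) * (2 * r%:R).
(* A sum of nonnegative terms, so [Y <= ln n] gives all size conditions on [y] at once. *)
pose Y : R := 36 * k%:R ^+ 3 + (2 * `|K| + 1) + 4 * r%:R ^+ 2 * (r%:R + 1) ^+ k.
apply/cvgrPdist_le => eps eps0; near=> n.
have nr : (r <= n)%N by near: n; exact: nbhs_infty_ge.
have n2 : (2 <= n)%N by lia.
have n0 : 0 < n%:R :> R by rewrite ltr0n; lia.
have neps : n%:R^-1 <= eps.
  rewrite -[eps]invrK lef_pV2 ?posrE ?invr_gt0 //.
  by near: n; exact: nbhs_infty_ger.
have yY : Y <= ln n%:R.
  rewrite -ler_expR lnK ?posrE //.
  by near: n; exact: nbhs_infty_ger.
set y := ln n%:R in yY *.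
have Y1 : 0 <= 36 * k%:R ^+ 3 :> R by rewrite mulr_ge0 // exprn_ge0.
have Y2 : 0 <= `|K| by exact: normr_ge0.
have Y3 : 0 <= 4 * r%:R ^+ 2 * (r%:R + 1) ^+ k :> R.
  by rewrite !mulr_ge0 ?exprn_ge0 // addr_ge0.
have KK := ler_norm K.
have [yk yK yr y1] : [/\ 36 * k%:R ^+ 3 <= y, 2 * K + 1 <= y,
    4 * r%:R ^+ 2 * (r%:R + 1) ^+ k <= y & 1 <= y].
  by rewrite /Y in yY; split; lra.
have y0 : 0 < y by lra.
have rn : (1 < r <= n)%N by rewrite nr andbT ltnW.
rewrite powR_threshold //; last exact: ltnW.
set N := expR (y / k%:R); set x := _ / _.
have x0 : 0 <= x by rewrite divr_ge0 ?mulr_ge0 ?expR_ge0 ?exprn_ge0 // ltW.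
have N0 : 0 <= N / y by rewrite divr_ge0 ?expR_ge0 // ltW.
(* [D] is rounded down to keep half of the sets available; [m] is rounded up so that [m] edges reach
   the threshold [x]. *)
pose D := Num.truncn (N / y); pose m := (Num.truncn x).+1.
have /andP[D1 D2] := truncn_itv N0.
have /andP[m1 m2] := truncn_itv x0.
have yN : y <= N.
  by apply: le_trans (expR_ge_quadratic k0 yk); rewrite expr2; nra.
have fail : n%:R * (1 + (expR 1 - 1) * (2 * r%:R / n%:R)) ^+ m / expR 1 ^+ D
    <= n%:R^-1 :> R.
  apply: (prob_failure_le k0 n2 yk yK D2).
  by rewrite -natr1 lerD2r.
have hD := deg_bound_le k0 (ltnW (ltnW r3)) n2 yr yN D1.
have b1 : 1 <= expR 1 :> R by rewrite ltW // expR_gt1.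
rewrite ger0_norm ?subr_ge0 ?prob_final_edges_ge_le1 // lerBlDl -lerBlDr.
apply: le_trans (prob_final_edges_lb b1 rn hl hD (ltW m2)).
by rewrite lerD2l lerN2; exact: le_trans neps.
Unshelve. all: by end_near.
Qed.
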